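(* Assume that the testing problem is truncatable. Let $\psi$ be a stopping rule. Then $$L(\psi)=\inf_{\psi'}L(\psi')$$ (infimum over all stopping rules $\psi'$) if and only if $$I_{\{l_m<f_\theta^m+R_m\}}\le\psi_m\le I_{\{l_m\le f_\theta^m+R_m\}}\quad\mu^m\text{-almost everywhere on } C_m^\psi$$ for all $m=1,2,\dots$.
   Context: Setting. Let $k\ge2$ and let $X_1,X_2,\dots$ be a discrete-time stochastic process with values in a measurable space $\mathcal X$, whose distribution $P_\vartheta$ depends on a parameter $\vartheta$. Let $\mu$ be a $\sigma$-finite measure on $\mathcal X$ and $\mu^n=\mu\otimes\cdots\otimes\mu$ ($n$ times). For every parameter value $\vartheta$ and every $n\ge 1$, under $P_\vartheta$ the vector $(X_1,\dots,X_n)$ has density $f_\vartheta^n(x_1,\dots,x_n)$ with respect to $\mu^n$ (in particular $\int f_\vartheta^{n+1}d\mu(x_{n+1})=f_\vartheta^n$ $\mu^n$-a.e.). Parameter values $\theta_1,\dots,\theta_k$ and one more fixed parameter value $\theta$ (not necessarily one of the $\theta_i$) are given. For a function $F_n=F_n(x_1,\dots,x_n)$, $E_\vartheta F_n=E_\vartheta F_n(X_1,\dots,X_n)=\int F_n f^n_\vartheta\,d\mu^n$. A stopping rule is a sequence $\psi=(\psi_1,\psi_2,\dots)$ of measurable functions $\psi_n=\psi_n(x_1,\dots,x_n)$ with values in $[0,1]$. A decision rule is a sequence $\phi=(\phi_1,\phi_2,\dots)$, $\phi_n=(\phi_n^1,\dots,\phi_n^k)$, of measurable functions of $(x_1,\dots,x_n)$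 with $\phi_n^i\ge0$ and $\sum_{i=1}^k\phi_n^i=1$. The stopping time $\tau_\psi$ has distribution $P_\vartheta(\tau_\psi=n)=E_\vartheta(1-\psi_1)\cdots(1-\psi_{n-1})\psi_n$, and $P_\vartheta(\tau_\psi<\infty)=\sum_{n\ge1}P_\vartheta(\tau_\psi=n)$. $\alpha_{ij}(\psi,\phi)=\sum_{n=1}^\infty E_{\theta_i}(1-\psi_1)\cdots(1-\psi_{n-1})\psi_n\phi_n^j$. $N(\psi)=E_\theta\tau_\psi=\sum_{n=1}^\infty nP_\theta(\tau_\psi=n)$ if $P_\theta(\tau_\psi<\infty)=1$, and $N(\psi)=\infty$ otherwise. Constants $\lambda_{ij}\ge0$ ($1\le i,j\le k$, $i\ne j$) are fixed. $L(\psi,\phi)=N(\psi)+\sum_{i\ne j}\lambda_{ij}\alpha_{ij}(\psi,\phi)$ and $l_n=\min_{1\le j\le k}\sum_{i\ne j}\lambda_{ij}f^n_{\theta_i}$. $L(\psi)=\inf_\phi L(\psi,\phi)$ (infimum over all decision rules), which equals $\sum_{n=1}^\infty\int(1-\psi_1)\cdots(1-\psi_{n-1})\psi_n(nf_\theta^n+l_n)\,d\mu^n$ if $P_\theta(\tau_\psi<\infty)=1$ and $\infty$ otherwise. The testing problem is called truncatable if $\int(1-\psi_1)\cdots(1-\psi_{n-1})\,l_n\,d\mu^n\to0$ as $n\to\infty$ for every stopping rule $\psi$ with $E_\theta\tau_\psi<\infty$. For $N\ge1$ put $V_N^N\equiv l_N$ and, recursively for $m=N-1,\dots,1$, $V_m^N=\min\{l_m,\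 f_\theta^m+\int V_{m+1}^N(x_1,\dots,x_{m+1})\,d\mu(x_{m+1})\}$. For fixed $m$ the sequence $V_m^N$ is non-increasing in $N\ge m$; $V_m=\lim_{N\to\infty}V_m^N$. $R_m=R_m(x_1,\dots,x_m)=\int V_{m+1}(x_1,\dots,x_{m+1})\,d\mu(x_{m+1})$. $C_n^\psi=\{(x_1,\dots,x_n):(1-\psi_1(x_1))\cdots(1-\psi_{n-1}(x_1,\dots,x_{n-1}))>0\}$ (with the empty product equal to $1$ for $n=1$). $I_A$ is the indicator function of $A$. *)

(* Defs.v *)
From HB Require Import structures.
From mathcomp Require Import all_boot all_order all_algebra.
From mathcomp Require Import all_classical all_reals all_analysis.

Set Implicit Arguments.
Unset Strict Implicit.
Unset Printing Implicit Defensive.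
Import Order.TTheory GRing.Theory Num.Theory.
Import numFieldNormedType.Exports.
Local Open Scope classical_set_scope.
Local Open Scope ring_scope.
Local Open Scope ereal_scope.

(* A sequence of functions F_n(x_1, ..., x_n), n >= 1, is a family
   F : forall n, n.-tuple T -> _ indexed by the actual value of n, and the
   process X_1, X_2, ... is X 1, X 2, ...  The members F 0 and X 0 are
   placeholders: nothing below depends on them or constrains them. *)

Section PowerMeasure.
Context {d : measure_display} {T : measurableType d} {R : realType}.

Definition snoc (n : nat) (p : n.-tuple T * T) : n.+1.-tuple T :=
  [tuple of rcons p.1 p.2].

Lemma measurable_snoc (n : nat) :
  measurable_fun [set: n.-tuple T * T] (@snoc n).
Proof.
apply/measurable_fun_tnthP => i; have [ltin|lein] := ltnP i n.
- rewrite (_ : _ \o _ = (@tnth n T ^~ (Ordinal ltin)) \o fst).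
    by apply: measurableT_comp => //; exact: measurable_tnth.
  by apply/funext=> -[x y] /=; rewrite !(tnth_nth y)/= nth_rcons size_tuple ltin.
- rewrite (_ : _ \o _ = snd)//.
  apply/funext=> -[x y] /=; rewrite (tnth_nth y)/= nth_rcons size_tuple.
  have -> : i = n :> nat by apply/eqP; rewrite eqn_leq lein -ltnS ltn_ord.
  by rewrite ltnn eqxx.
Qed.

Variable mu : {sigma_finite_measure set T -> \bar R}.

Section SnocMeasure.
Variables (n : nat) (m : {measure set (n.-tuple T) -> \bar R}).

Definition snoc_measure : set (n.+1.-tuple T) -> \bar R :=
  pushforward (m \x mu) (@snoc n).

Let mf := @measurable_snoc n.

Let snoc_measure0 : snoc_measure set0 = 0.
Proof. exact: measure0. Qed.

Let snoc_measure_ge0 A : 0 <= snoc_measure A.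
Proof. exact: measure_ge0. Qed.

Let snoc_measure_sigma_additive : semi_sigma_additive snoc_measure.
Proof. exact: measure_semi_sigma_additive. Qed.

HB.instance Definition _ := isMeasure.Build _ _ _ snoc_measure
  snoc_measure0 snoc_measure_ge0 snoc_measure_sigma_additive.

End SnocMeasure.

(* mu ^ n as a measure on n.-tuple T, via T ^ n.+1 = T ^ n * T. *)
Fixpoint power_measure (n : nat) : {measure set (n.-tuple T) -> \bar R} :=
  match n with
  | 0 => \d_ ([tuple] : 0.-tuple T)
  | m.+1 => snoc_measure (power_measure m)
  end.

End PowerMeasure.

Section Rules.
Context {d : measure_display} {T : measurableType d} {R : realType}.

(* (x_1, ..., x_n) |-> (x_1, ..., x_i) *)
Definition first_obs (n : nat) (i : 'I_n) (x : n.-tuple T) : i.-tuple T :=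
  [tuple tnth x (widen_ord (ltnW (ltn_ord i)) j) | j < i].

Definition stopping_rule (psi : forall n : nat, n.-tuple T -> R) : Prop :=
  forall n : nat, (0 < n)%N ->
    measurable_fun [set: n.-tuple T] (psi n) /\
    forall x, (0 <= psi n x <= 1)%R.

Definition decision_rule (k : nat)
    (phi : forall n : nat, n.-tuple T -> 'I_k -> R) : Prop :=
  forall n : nat, (0 < n)%N ->
    (forall j, measurable_fun [set: n.-tuple T] (fun x => phi n x j)) /\
    forall x, (forall j, (0 <= phi n x j)%R) /\
      (\sum_(j < k) phi n x j = 1)%R.

(* (1 - psi_1) ... (1 - psi_{n-1}) as a function of (x_1, ..., x_n); the
   ordinal bound i < n together with 0 < i gives i = 1, ..., n - 1. *)
Definition cont_prob (psi : forall n : nat, n.-tuple T -> R) (n : nat)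
    (x : n.-tuple T) : R :=
  (\prod_(i < n | (0 < i)%N) (1 - psi i (first_obs i x)))%R.

Definition cont_set (psi : forall n : nat, n.-tuple T -> R) (n : nat) :
    set (n.-tuple T) :=
  [set x | (0 < cont_prob psi x)%R].

End Rules.
Arguments cont_set {d T R} psi n.

Section Model.
Context {d dO : measure_display} {T : measurableType d}
  {Omega : measurableType dO} {R : realType} {Theta : Type}.
Variables (P : Theta -> probability Omega R) (X : nat -> {mfun Omega >-> T}).

Definition observe (n : nat) (w : Omega) : n.-tuple T :=
  [tuple X i.+1 w | i < n].

Definition has_densities (mu : {sigma_finite_measure set T -> \bar R})
    (f : Theta -> forall n : nat, n.-tuple T -> R) : Prop :=
  forall (th : Theta) (n : nat), (0 < n)%N ->
    [/\ measurable_fun [set: n.-tuple T] (f th n),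
        forall x, (0 <= f th n x)%R &
        forall A, measurable A ->
          P th (observe n @^-1` A) =
          \int[power_measure mu n]_(x in A) (f th n x)%:E].

Definition expect (th : Theta) (n : nat) (F : n.-tuple T -> R) : \bar R :=
  'E_(P th)[F \o observe n].

(* The (randomized) stopping time tau_psi enters only through its law:
   stop_prob th psi n is P_th(tau_psi = n). *)
Definition stop_prob (th : Theta) (psi : forall n : nat, n.-tuple T -> R)
    (n : nat) : \bar R :=
  expect th (fun x : n.-tuple T => cont_prob psi x * psi n x)%R.

Definition stop_finite_prob (th : Theta)
    (psi : forall n : nat, n.-tuple T -> R) : \bar R :=
  \sum_(1 <= n <oo) stop_prob th psi n.

(* E_th tau_psi, with value +oo when P_th(tau_psi < oo) < 1. *)
Definition avg_sample (th : Theta) (psi : forall n : nat, n.-tuple T -> R) :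
    \bar R :=
  if stop_finite_prob th psi == 1
  then \sum_(1 <= n <oo) n%:R%:E * stop_prob th psi n else +oo.

Variables (k : nat) (ths : 'I_k -> Theta) (th0 : Theta).

Definition error_prob (psi : forall n : nat, n.-tuple T -> R)
    (phi : forall n : nat, n.-tuple T -> 'I_k -> R) (i j : 'I_k) : \bar R :=
  \sum_(1 <= n <oo)
    expect (ths i)
      (fun x : n.-tuple T => cont_prob psi x * psi n x * phi n x j)%R.

(* The values lambda i i are never used. *)
Variable lambda : 'I_k -> 'I_k -> R.

Definition lagrangian (psi : forall n : nat, n.-tuple T -> R)
    (phi : forall n : nat, n.-tuple T -> 'I_k -> R) : \bar R :=
  avg_sample th0 psi +
  \sum_(i < k) \sum_(j < k | i != j) (lambda i j)%:E * error_prob psi phi i j.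

Definition min_lagrangian (psi : forall n : nat, n.-tuple T -> R) : \bar R :=
  ereal_inf [set lagrangian psi phi | phi in @decision_rule _ T R k].

Variables (mu : {sigma_finite_measure set T -> \bar R})
  (f : Theta -> forall n : nat, n.-tuple T -> R).

(* The minimum is over a nonempty index set when 0 < k, so that the neutral
   element +oo plays no role. *)
Definition ell (n : nat) (x : n.-tuple T) : \bar R :=
  \big[Order.min/+oo]_(j < k)
    (\sum_(i < k | i != j) lambda i j * f (ths i) x)%R%:E.

Definition truncatable : Prop :=
  forall psi : (forall n : nat, n.-tuple T -> R), stopping_rule psi ->
    avg_sample th0 psi < +oo ->
    (fun n : nat => \int[power_measure mu n]_x
       ((cont_prob psi x)%:E * ell x)) @ \oo --> 0.

(* V_m^{m+s}: s backward steps separate the horizon from the stage m. *)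
Fixpoint V_steps (s m : nat) (x : m.-tuple T) : \bar R :=
  match s with
  | 0 => ell x
  | s'.+1 => Order.min (ell x)
      ((f th0 x)%:E + \int[mu]_y V_steps s' (snoc (x, y)))
  end.

(* V_m^N, meaningful for 1 <= m <= N. *)
Definition V_trunc (N m : nat) (x : m.-tuple T) : \bar R := V_steps (N - m) x.

Definition V_lim (m : nat) (x : m.-tuple T) : \bar R :=
  limn (fun N => V_trunc N x).

Definition Rcont (m : nat) (x : m.-tuple T) : \bar R :=
  \int[mu]_y V_lim (snoc (x, y)).

End Model.

(* Main.v *)
Require Import Defs.
From HB Require Import structures.
From mathcomp Require Import all_boot all_order all_algebra.
From mathcomp Require Import all_classical all_reals all_analysis.
From mathcomp Require Import measurable_realfun ring lra.
Set Implicit Arguments.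
Unset Strict Implicit.
Unset Printing Implicit Defensive.
Import Order.TTheory GRing.Theory Num.Theory.
Import numFieldNormedType.Exports.
Local Open Scope classical_set_scope.
Local Open Scope ring_scope.
Local Open Scope ereal_scope.

(** The theorem holds because the Lagrangian of a stopping rule [psi] can be
    bounded below by a sequence that starts at a number free of [psi] and that
    stays constant exactly when [psi] solves the one-step problem of every stage.

    Two rewritings turn the Lagrangian into an increasing limit.  First, the
    mean sample number is the sum over [n] of P(tau >= n): this holds without
    assuming that tau is finite, because both sides are infinite when it is not
    ([avg_sample_surv]).  Second, the best decision rule picks at each stage a
    hypothesis of least weighted density, so that stopping at stage [n] costs
    [ell] ([min_lagrangianE]).  Hence min_lagrangian psi is the limit of
    [cost_until n], the cost of the first [n] observations together with the
    risk of the decisions taken before stage [n].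

    Complete this partial cost with what an optimal player would still pay from
    stage [n] on: [value_bound n = cost_until n + int c_n V_n], where [c_n] is
    the conditional probability of not having stopped before [n].  Dominated
    convergence in the truncated recursions gives the Bellman equation
    [V_n = min (ell, f + R_n)] almost everywhere ([V_lim_bellman]), while going
    from stage [n] to stage [n + 1] replaces [c_n V_n] by
    [c_n (psi_n ell + (1 - psi_n) (f + R_n))].  So [value_bound] increases with
    [n], and its step at [n] vanishes exactly when [psi_n] puts its mass on the
    smaller of the two costs almost everywhere on [c_n > 0] ([cont_value_eq]):
    this is the condition of the theorem at stage [n].  At [n = 1] its value is
    [opt_value = 1 + int V_1], whatever [psi] is.

    If the Lagrangian is finite, truncatability makes [int c_n V_n] vanish in
    the limit, so that [value_bound n] increases to min_lagrangian psi.  This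
    gives the lower bound [opt_value], and equality forces every step to vanish.
    Conversely, if every step vanishes, then [cost_until n <= opt_value] for all
    [n], hence min_lagrangian psi <= [opt_value] ([min_lagrangian_opt]).  The
    rule that stops as soon as [ell <= f + R_n] satisfies the condition, so the
    infimum over all stopping rules is [opt_value]. *)

(** * Integrals of nonnegative functions *)

Section IntegralRepresentation.
Context {d : measure_display} {T : measurableType d} {R : realType}.
Import HBNNSimple.

(** A nonnegative measurable function is an increasing limit of simple
    functions, so that linearity and monotone continuity propagate agreement on
    indicators.  Both the integration against a density and the iterated
    integral over successive observations are identified in this way. *)
Lemma integral_unique (nu : {measure set T -> \bar R})
    (I : (T -> \bar R) -> \bar R) :
  (forall A, measurable A -> I (fun x => (\1_A x)%:E) = nu A) ->
  (forall (c : R) (g : T -> \bar R), (0 <= c)%R -> measurable_fun [set: T] g ->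
     (forall x, 0 <= g x) -> I (fun x => c%:E * g x) = c%:E * I g) ->
  (forall g h : T -> \bar R, measurable_fun [set: T] g -> measurable_fun setT h ->
     (forall x, 0 <= g x) -> (forall x, 0 <= h x) ->
     I (g \+ h) = I g + I h) ->
  (forall g : nat -> T -> \bar R, (forall n, measurable_fun [set: T] (g n)) ->
     (forall n x, 0 <= g n x) -> (forall x, nondecreasing_seq (g ^~ x)) ->
     I (fun x => limn (g ^~ x)) = limn (fun n => I (g n))) ->
  forall g, measurable_fun [set: T] g -> (forall x, 0 <= g x) ->
  I g = \int[nu]_x g x.
Proof.
move=> I1 IZ ID Ilim g mg g0.
have I0 : I (fun=> 0) = 0.
  transitivity (nu set0); last exact: measure0.
  by rewrite -I1//; congr I; apply/funext => x; rewrite indic0.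
pose h := nnsfun_approx measurableT mg.
have gE : g = (fun x => limn (fun n => (h n x)%:E)).
  by apply/funext => x; apply/esym/cvg_lim => //; exact: cvg_nnsfun_approx.
have mh n : measurable_fun [set: T] (fun x => (h n x)%:E) by exact/measurable_EFinP.
have h0 n x : 0 <= (h n x)%:E by rewrite lee_fin.
have ndh x : nondecreasing_seq (fun n => (h n x)%:E).
  by move=> a b ab; rewrite lee_fin; exact/lefP/nd_nnsfun_approx.
rewrite gE (Ilim (fun n x => (h n x)%:E))// monotone_convergence//.
congr (limn _); apply/funext => n.
have hE : (fun x => (h n x)%:E) =
    (fun x => \sum_(y <- finmap.enum_fset (fset_set (range (h n))))
      (y%:E * (\1_(h n @^-1` [set y]) x)%:E)).
  apply/funext => x; rewrite fimfunE fsbig_finite//= -sumEFin.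
  by apply: eq_bigr => y _; rewrite EFinM.
have yh0 : all (fun y : R => (0 <= y)%R) (finmap.enum_fset (fset_set (range (h n)))).
  by apply/allP => y; rewrite in_fset_set// inE => -[x _ <-].
rewrite hE; elim: (finmap.enum_fset _) yh0 => [_|y s IH /= /andP[y0 s0]].
  rewrite (_ : (fun x => _) = fun=> 0) ?I0 ?integral0//.
  by apply/funext => x; rewrite big_nil.
have mi z : measurable_fun [set: T] (fun x => (\1_(h n @^-1` [set z]) x)%:E : \bar R).
  exact/measurable_EFinP.
have mzi z : measurable_fun [set: T]
    (fun x => z%:E * (\1_(h n @^-1` [set z]) x)%:E : \bar R).
  exact: measurable_funeM.
have sg0 x : 0 <= \sum_(y <- s) (y%:E * (\1_(h n @^-1` [set y]) x)%:E).
  rewrite big_seq; apply: sume_ge0 => z /(allP s0) z0.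
  by rewrite mule_ge0 ?lee_fin.
have ms : measurable_fun [set: T]
    (fun x => \sum_(y <- s) (y%:E * (\1_(h n @^-1` [set y]) x)%:E)).
  exact: emeasurable_sum.
rewrite (_ : (fun x => _) = (fun x => y%:E * (\1_(h n @^-1` [set y]) x)%:E) \+
    (fun x => \sum_(y <- s) (y%:E * (\1_(h n @^-1` [set y]) x)%:E))); last first.
  by apply/funext => x; rewrite big_cons.
rewrite ID//; last by move=> x; rewrite mule_ge0 ?lee_fin.
rewrite ge0_integralD//; last by move=> x _; rewrite mule_ge0 ?lee_fin.
rewrite IH// IZ// I1// ge0_integralZl//.
by rewrite integral_indic ?setIT.
Qed.

Lemma integral_density (mu nu : {measure set T -> \bar R}) (p : T -> R) :
  measurable_fun [set: T] p -> (forall x, (0 <= p x)%R) ->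
  (forall A, measurable A -> nu A = \int[mu]_(x in A) (p x)%:E) ->
  forall g, measurable_fun [set: T] g -> (forall x, 0 <= g x) ->
  \int[nu]_x g x = \int[mu]_x (g x * (p x)%:E).
Proof.
move=> mp p0 nuE g mg g0; apply/esym.
have mEp : measurable_fun [set: T] (EFin \o p) by exact/measurable_EFinP.
apply: (@integral_unique nu (fun g => \int[mu]_x (g x * (p x)%:E))) => //.
- move=> A mA; rewrite nuE// [RHS]integral_mkcond.
  apply: eq_integral => x _; rewrite muleC.
  by have -> := epatch_indic (EFin \o p) A.
- move=> c {}g c0 {}mg {}g0; rewrite -ge0_integralZl//.
  + by apply: eq_integral => x _; rewrite muleA.
  + exact: emeasurable_funM.
  + by move=> x _; rewrite mule_ge0// lee_fin.
- move=> {}g h {}mg mh {}g0 h0; rewrite -ge0_integralD//.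
  + by apply: eq_integral => x _; rewrite ge0_muleDl.
  + by move=> x _; rewrite mule_ge0// lee_fin.
  + exact: emeasurable_funM.
  + by move=> x _; rewrite mule_ge0// lee_fin.
  + exact: emeasurable_funM.
- move=> {mg g0}g mg g0 ndg; rewrite -monotone_convergence//.
  + apply: eq_integral => x _; apply/esym/cvg_lim => //.
    apply: cvgeZr => //; apply: ereal_nondecreasing_is_cvgn.
    exact: ndg.
  + by move=> n; exact: emeasurable_funM.
  + by move=> n x _; rewrite mule_ge0// lee_fin.
  + by move=> x _ a b ab; rewrite lee_wpmul2r ?lee_fin//; exact: ndg.
Qed.

(** Finiteness of the integral makes both functions finite almost everywhere,
    so that their difference is a nonnegative function of null integral. *)
Lemma ge0_integral_eq_ae (mu : {measure set T -> \bar R}) (g h : T -> \bar R) :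
  measurable_fun [set: T] g -> measurable_fun setT h ->
  (forall x, 0 <= g x) -> (forall x, 0 <= h x) ->
  {ae mu, forall x, g x <= h x} ->
  \int[mu]_x h x <= \int[mu]_x g x -> \int[mu]_x g x < +oo ->
  {ae mu, forall x, g x = h x}.
Proof.
move=> mg mh g0 h0 gh hg goo.
have hgE : \int[mu]_x h x = \int[mu]_x g x.
  apply/eqP; rewrite eq_le hg/=; apply: ae_ge0_le_integral => //.
  by apply: filterS gh => x ? _.
have ig : mu.-integrable [set: T] g.
  by apply/integrableP; split => //; under eq_integral do rewrite gee0_abs//.
have ih : mu.-integrable [set: T] h.
  apply/integrableP; split => //; under eq_integral do rewrite gee0_abs//.
  by rewrite hgE.
have mhg : measurable_fun [set: T] (h \- g) by exact: emeasurable_funB.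
have : \int[mu]_x `|(h \- g) x| = 0.
  transitivity (\int[mu]_x (h \- g) x); last first.
    by rewrite integralB// hgE subee// ge0_fin_numE// integral_ge0.
  apply: ae_eq_integral => //; first exact: measurableT_comp.
  have gfin := integrable_ae measurableT ig.
  have hfin := integrable_ae measurableT ih.
  apply: filterS3 gh gfin hfin => x gh /(_ I) gx /(_ I) hx _.
  by rewrite gee0_abs// sube_ge0 ?gx.
move/(ae_eq_integral_abs _ measurableT mhg) => hg0.
have gfin := integrable_ae measurableT ig.
apply: filterS2 gfin hg0 => x /(_ I) + /(_ I)/=.
by case: (g x) => // r _; case: (h x) => //= s [/subr0_eq ->].
Qed.

End IntegralRepresentation.

Section Tonelli.
Context {d : measure_display} {T : measurableType d} {R : realType}.
Variable mu : {sigma_finite_measure set T -> \bar R}.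

Lemma measurable_integral_snoc n (g : n.+1.-tuple T -> \bar R) :
  measurable_fun [set: n.+1.-tuple T] g -> (forall x, 0 <= g x) ->
  measurable_fun [set: n.-tuple T] (fun x => \int[mu]_y g (snoc (x, y))).
Proof.
move=> mg g0.
apply: (@measurable_fun_fubini_tonelli_F _ _ _ _ _ mu (g \o @snoc _ T n)) => //.
  by apply: measurableT_comp => //; exact: measurable_snoc.
by move=> x; exact: g0.
Qed.

Lemma measurable_snoc_r n (x : n.-tuple T) :
  measurable_fun [set: T] (fun y => snoc (x, y)).
Proof.
by apply: (measurableT_comp (@measurable_snoc _ T n)); exact: measurable_fun_pair.
Qed.

Lemma measurable_snoc_app n (g : n.+1.-tuple T -> \bar R) (x : n.-tuple T) :
  measurable_fun [set: n.+1.-tuple T] g ->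
  measurable_fun [set: T] (fun y => g (snoc (x, y))).
Proof. by move=> mg; apply: measurableT_comp => //; exact: measurable_snoc_r. Qed.

(** Tonelli's theorem for the last observation: the product measure is by
    definition an iterated integral of sections, which settles indicators. *)
Lemma integral_power_measureS n (g : n.+1.-tuple T -> \bar R) :
  measurable_fun [set: n.+1.-tuple T] g -> (forall x, 0 <= g x) ->
  \int[power_measure mu n.+1]_x g x =
  \int[power_measure mu n]_x \int[mu]_y g (snoc (x, y)).
Proof.
move=> mg g0; apply/esym.
apply: (@integral_unique _ _ _ (power_measure mu n.+1)
  (fun g => \int[power_measure mu n]_x \int[mu]_y g (snoc (x, y)))) => //.
- move=> A mA; rewrite [RHS]/= /snoc_measure /pushforward /product_measure1.
  apply: eq_integral => x _ /=.
  rewrite (_ : (fun y => (\1_A (snoc (x, y)))%:E) = (fun y =>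
    (\1_(xsection (@snoc _ T n @^-1` A) x) y)%:E)).
    rewrite integral_indic ?setIT//; apply: measurable_xsection.
    by rewrite -[_ @^-1` _]setTI; exact: measurable_snoc.
  by apply/funext => y; rewrite !indicE mem_xsection.
- move=> c {}g c0 {}mg {}g0; rewrite -ge0_integralZl//.
  + apply: eq_integral => x _; rewrite ge0_integralZl//.
    exact: measurable_snoc_app.
  + exact: measurable_integral_snoc.
  + by move=> x _; exact: integral_ge0.
- move=> {}g h {}mg mh {}g0 h0; rewrite -ge0_integralD//.
  + apply: eq_integral => x _; rewrite ge0_integralD//.
    * exact: measurable_snoc_app.
    * exact: measurable_snoc_app.
  + by move=> x _; exact: integral_ge0.
  + exact: measurable_integral_snoc.
  + by move=> x _; exact: integral_ge0.
  + exact: measurable_integral_snoc.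
- move=> {mg g0}g mg g0 ndg; rewrite -monotone_convergence//.
  + apply: eq_integral => x _; rewrite monotone_convergence//.
    by move=> m; exact: measurable_snoc_app.
  + by move=> m; exact: measurable_integral_snoc.
  + by move=> m x _; exact: integral_ge0.
  + move=> x _ a b ab; apply: ge0_le_integral => //.
    * exact: measurable_snoc_app.
    * exact: measurable_snoc_app.
    * by move=> y _; exact: ndg.
Qed.

End Tonelli.

(** * Series and the expectation as a sum of tails *)

Lemma eq_eseries_from {R : realType} (u v : nat -> \bar R) m :
  (forall n, (m <= n)%N -> u n = v n) ->
  \sum_(m <= n <oo) u n = \sum_(m <= n <oo) v n.
Proof.
move=> uv; congr (limn _); apply/funext => N.
by apply: eq_big_nat => n /andP[mn _]; exact: uv.
Qed.

Lemma lee_nneseries_from {R : realType} (u v : nat -> \bar R) m :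
  (forall n, (m <= n)%N -> 0 <= u n) -> (forall n, (m <= n)%N -> u n <= v n) ->
  \sum_(m <= n <oo) u n <= \sum_(m <= n <oo) v n.
Proof.
move=> u0 uv; apply: lee_lim.
- by apply: is_cvg_nneseries => n mn _; exact: u0.
- by apply: is_cvg_nneseries => n mn _; rewrite (le_trans _ (uv _ mn))// u0.
- apply: nearW => N; rewrite big_nat_cond [leRHS]big_nat_cond.
  by apply: lee_sum => n /andP[/andP[mn _] _]; exact: uv.
Qed.

Lemma nneseriesZl_from {R : realType} (u : nat -> \bar R) (c : R) m :
  (forall n, (m <= n)%N -> 0 <= u n) ->
  c%:E * \sum_(m <= n <oo) u n = \sum_(m <= n <oo) c%:E * u n.
Proof.
move=> u0; pose v n := if (m <= n)%N then u n else 0.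
have uv n : (m <= n)%N -> u n = v n by rewrite /v => ->.
rewrite (eq_eseries_from uv) -nneseriesZl; last first.
  by move=> n _; rewrite /v; case: ifP => // /u0.
by apply: eq_eseries_from => n /uv ->.
Qed.

(** Here [p n] and [a n] stand for the probabilities that an extended
    positive integer is equal to [n] and at least [n]. *)
Section TailSum.
Context {R : realType}.
Variables a p : nat -> R.
Hypothesis a0 : forall n, (0 <= a n)%R.
Hypothesis p0 : forall n, (0 < n)%N -> (0 <= p n)%R.
Hypothesis a1 : a 1%N = 1%R.
Hypothesis aS : forall n, (0 < n)%N -> a n = (p n + a n.+1)%R.

Let sum_p N : \sum_(1 <= n < N.+1) (p n)%:E = (1 - a N.+1)%:E.
Proof.
elim: N => [|N IH]; first by rewrite big_geq// a1 subrr.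
by rewrite big_nat_recr//= IH -EFinD (aS (n := N.+1))//; congr EFin; ring.
Qed.

Let a_noninc : nonincreasing_seq (fun n => a n.+1).
Proof. by apply/nonincreasing_seqP => n; rewrite (aS (n := n.+1))// lerDr p0. Qed.

Let sum_np N : \sum_(1 <= n < N.+1) (n%:R%:E * (p n)%:E) =
  (\sum_(1 <= n < N.+1) a n - N%:R * a N.+1)%:E.
Proof.
elim: N => [|N IH]; first by rewrite !big_geq// mul0r subrr.
rewrite [in RHS]big_nat_recr//= [in LHS]big_nat_recr//= IH -EFinM -EFinD.
rewrite (aS (n := N.+1))//; congr EFin.
by rewrite -natr1; ring.
Qed.

(** With [c] the limit of [a], the masses [p n] add up to [1 - c].  If [c = 0],
    summation by parts leaves the boundary term [N a_(N+1)], controlled by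
    cutting the series at a fixed [M]; if [c > 0], the tails are bounded below
    and their sum is infinite, like the expectation. *)
Lemma expectation_tail_sum :
  (if \sum_(1 <= n <oo) (p n)%:E == 1
   then \sum_(1 <= n <oo) n%:R%:E * (p n)%:E else +oo)
  = \sum_(1 <= n <oo) (a n)%:E.
Proof.
have acvg : (fun n => a n.+1) @ \oo --> inf (range (fun n => a n.+1)).
  by apply: nonincreasing_cvgn => //; exists 0%R => _ [n _ <-].
set c := inf _ in acvg.
have ca n : (c <= a n.+1)%R.
  by apply: ge_inf; [exists 0%R => _ [m _ <-]|exists n].
have sp : \sum_(1 <= n <oo) (p n)%:E = (1 - c)%:E.
  apply/cvg_lim => //; rewrite -(cvg_shiftn 1)/=.
  under eq_fun do rewrite addn1 sum_p.
  by apply: cvg_EFin; [exact: nearW|apply: cvgB => //; exact: cvg_cst].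
rewrite sp; case: ifPn => [|c0].
  rewrite eqe subr_eq addrC -subr_eq subrr eq_sym => /eqP c0.
  apply/eqP; rewrite eq_le; apply/andP; split.
  - apply: lime_le.
      by apply: is_cvg_nneseries => n n0 _; rewrite mule_ge0 ?lee_fin ?p0.
    apply: nearW => -[|N].
      by rewrite big_geq// nneseries_ge0// => n _ _; rewrite lee_fin.
    rewrite sum_np; apply: (@le_trans _ _ (\sum_(1 <= n < N.+1) (a n)%:E)).
      by rewrite sumEFin lee_fin gerBl mulr_ge0.
    by apply: nneseries_lim_ge => n _ _; rewrite lee_fin.
  - apply: lime_le; first by apply: is_cvg_nneseries => n _ _; rewrite lee_fin.
    apply: nearW => -[|M].
      rewrite big_geq// nneseries_ge0// => n n0 _.
      by rewrite mule_ge0 ?lee_fin ?p0.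
    (* For N >= M, the first M tails exceed the mean truncated at N by at most
       M a_(N+1), which tends to 0 since M is fixed. *)
    have lim0 : (fun N => \sum_(1 <= n <oo) n%:R%:E * (p n)%:E + (M%:R * a N.+1)%:E)
        @ \oo --> \sum_(1 <= n <oo) n%:R%:E * (p n)%:E + 0%:E.
      apply: cvgeD; [by rewrite fin_num_adde_defl|exact: cvg_cst|].
      apply: cvg_EFin; first exact: nearW.
      by rewrite -[X in _ --> X](mulr0 M%:R) -c0; apply: cvgM => //; exact: cvg_cst.
    rewrite -[leRHS]adde0 -(cvg_lim _ lim0)//; apply: lime_ge.
      exact: cvgP lim0.
    exists M => // N /= MN.
    have aM : (\sum_(1 <= n < M.+1) a n + (N - M)%:R * a N.+1 <=
               \sum_(1 <= n < N.+1) a n)%R.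
      rewrite [leRHS](big_cat_nat (n := M.+1))//= lerD2l.
      rewrite mulr_natl -subSS -(sumr_const_nat N.+1 M.+1 (a N.+1)).
      apply: ler_sum_nat => -[//|n] /andP[_ nN].
      by rewrite ltnS in nN; exact: a_noninc (ltnW nN).
    apply: (@le_trans _ _ (\sum_(1 <= n < N.+1) (n%:R%:E * (p n)%:E) +
        (M%:R * a N.+1)%:E)); last first.
      rewrite leeD2r//; apply: nneseries_lim_ge => n n0 _.
      by rewrite mule_ge0 ?lee_fin ?p0.
    rewrite sum_np -EFinD sumEFin lee_fin.
    by move: aM; rewrite natrB//; lra.
apply/esym/eqyP => r r0.
have {c0} : (0 < c)%R.
  rewrite lt_neqAle; apply/andP; split.
    by apply: contraNneq c0 => <-; rewrite subr0.
  by apply: lb_le_inf; [exists (a 1), 0%N|move=> _ [n _ <-]].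
(* Enough terms, each at least c, exceed any given r. *)
move=> c0; pose N := (Num.truncn (r / c)).+1.
apply: (@le_trans _ _ (\sum_(1 <= n < N.+1) (a n)%:E)); last first.
  by apply: nneseries_lim_ge => n _ _; rewrite lee_fin.
rewrite sumEFin lee_fin; apply: (@le_trans _ _ (N%:R * c)%R).
  by rewrite -ler_pdivrMr// ltW// truncnS_gt.
rewrite mulr_natl -[X in (_ *+ X <= _)%R]subn0 -subSS.
rewrite -(sumr_const_nat N.+1 1 c).
by apply: ler_sum_nat => -[//|n] _; exact: ca.
Qed.

End TailSum.

(** * Randomising between two costs *)

(** Mixing the costs [l] and [W] with weights [p] and [1 - p] attains their
    minimum exactly when no weight is put on the strictly larger one.  For
    [W = +oo] the convention [0 * +oo = 0] makes [p = 1] the only choice.  When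
    [c = 0] there is nothing to pay and [p] is unconstrained. *)
Lemma randomized_min {R : realType} (c p l : R) (W : \bar R) :
  (0 <= c)%R -> (0 <= p <= 1)%R -> 0 <= W ->
  c%:E * mine l%:E W = (c * p)%:E * l%:E + (c * (1 - p))%:E * W <->
  ((0 < c)%R -> ((l%:E < W)%E%:R <= p <= (l%:E <= W)%E%:R)%R).
Proof.
rewrite le_eqVlt => /predU1P[<-|c0] /andP[p0 p1] W0.
  by rewrite !mul0r !mul0e adde0 ltxx.
suff H : c%:E * mine l%:E W = (c * p)%:E * l%:E + (c * (1 - p))%:E * W <->
    ((l%:E < W)%E%:R <= p <= (l%:E <= W)%E%:R)%R.
  by split => [/H ? _//|/(_ c0) /H].
case: W W0 => [w| |]// _; last first.
  rewrite ltry leey /= p1 andbT (min_idPl _) ?leey//.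
  split => [|p1']; last first.
    have -> : p = 1%R by apply/eqP; rewrite eq_le p1.
    by rewrite subrr mulr0 mul0e adde0 mulr1.
  move: p1; rewrite le_eqVlt => /predU1P[->//|p1].
  by rewrite gt0_muley// lte_fin mulr_gt0// subr_gt0.
rewrite lte_fin lee_fin -EFin_min -!EFinM -EFinD.
have [lw|wl|->] /= := ltgtP l w.
- split => [[E]|p_eq1]; last first.
    by rewrite -(le_anti p_eq1) subrr mulr0 mul0r addr0 mulr1.
  have /eqP : (c * ((1 - p) * (w - l)) = 0)%R by lra.
  rewrite !mulf_eq0 gt_eqF//= subr_eq0 [(w - l)%R == _]gt_eqF ?subr_gt0// orbF.
  by move=> /eqP <-; rewrite lexx.
- split => [[E]|p_eq0]; last first.
    by rewrite -(le_anti p_eq0) subr0 mulr0 mul0r add0r mulr1.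
  have /eqP : (c * (p * (l - w)) = 0)%R by lra.
  rewrite !mulf_eq0 gt_eqF//= [(l - w)%R == _]gt_eqF ?subr_gt0// orbF.
  by move=> /eqP ->; rewrite lexx.
- by rewrite p0 p1; split => // _; congr EFin; ring.
Qed.

(** * Stopping rules along a growing sample *)

Section Rules.
Context {d : measure_display} {T : measurableType d} {R : realType}.
Implicit Type psi : forall n : nat, n.-tuple T -> R.

Lemma snoc_prefix n (x : n.-tuple T) y (i : 'I_n) :
  first_obs (widen_ord (leqnSn n) i) (snoc (x, y)) = first_obs i x.
Proof.
apply: eq_from_tnth => j; rewrite !tnth_mktuple !(tnth_nth y) /= nth_rcons.
by rewrite size_tuple ifT// (leq_trans (ltn_ord j))//= ltnW.
Qed.

Lemma snoc_prefix_max n (x : n.-tuple T) y :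
  first_obs (@ord_max n) (snoc (x, y)) = x.
Proof.
apply: eq_from_tnth => j; rewrite !tnth_mktuple !(tnth_nth y) /= nth_rcons.
by rewrite size_tuple ifT// (ltn_ord j).
Qed.

Lemma measurable_first_obs n (i : 'I_n) :
  measurable_fun [set: n.-tuple T] (@first_obs _ T n i).
Proof.
apply/measurable_fun_tnthP => j.
rewrite (_ : _ \o _ = @tnth n T ^~ (widen_ord (ltnW (ltn_ord i)) j)).
  exact: measurable_tnth.
by apply/funext => x /=; rewrite tnth_mktuple.
Qed.

Lemma cont_prob1 psi (x : 1.-tuple T) : cont_prob psi x = 1%R.
Proof. by rewrite /cont_prob big_pred0// => -[[|]]. Qed.

Lemma cont_prob_snoc psi n (x : n.-tuple T) y : (0 < n)%N ->
  cont_prob psi (snoc (x, y)) = (cont_prob psi x * (1 - psi n x))%R.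
Proof.
move=> n0; rewrite /cont_prob big_mkcond big_ord_recr/= n0 snoc_prefix_max.
rewrite [in RHS]big_mkcond; congr (_ * _)%R; apply: eq_bigr => i _ /=.
by rewrite snoc_prefix.
Qed.

Section StoppingRule.
Variable psi : forall n : nat, n.-tuple T -> R.
Hypothesis hpsi : stopping_rule psi.

Lemma psi_ge0 n (x : n.-tuple T) : (0 < n)%N -> (0 <= psi x)%R.
Proof. by move=> /hpsi[_ /(_ x)/andP[]]. Qed.

Lemma onem_psi_ge0 n (x : n.-tuple T) : (0 < n)%N -> (0 <= 1 - psi x)%R.
Proof. by move=> /hpsi[_ /(_ x)/andP[]]; rewrite subr_ge0. Qed.

Lemma measurable_psi n : (0 < n)%N ->
  measurable_fun [set: n.-tuple T] (psi (n:=n)).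
Proof. by move=> /hpsi[]. Qed.

Lemma cont_prob_ge0 n (x : n.-tuple T) : (0 <= cont_prob psi x)%R.
Proof. by apply: prodr_ge0 => i i0; exact: onem_psi_ge0. Qed.

Lemma cont_prob_le1 n (x : n.-tuple T) : (cont_prob psi x <= 1)%R.
Proof.
apply: prodr_ile1 => i i0.
by rewrite onem_psi_ge0//= gerBl psi_ge0.
Qed.

Lemma measurable_cont_prob n :
  measurable_fun [set: n.-tuple T] (@cont_prob _ T R psi n).
Proof.
rewrite (_ : cont_prob psi (n:=n) = fun x => (\prod_(i < n)
    if (0 < i)%N then 1 - psi (first_obs i x) else 1)%R); last first.
  by apply/funext => x; rewrite /cont_prob big_mkcond.
apply: (@measurable_prod _ _ _ _ _ _ (fun (i : 'I_n) (x : n.-tuple T) =>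
  if (0 < i)%N then (1 - psi (first_obs i x))%R else 1%R)) => i _.
case: ltnP => // i0; apply: measurable_funB => //.
by apply: (measurableT_comp (measurable_psi i0)); exact: measurable_first_obs.
Qed.

End StoppingRule.
End Rules.

(** * Expectations as integrals of densities *)

Section Law.
Context {d dO : measure_display} {T : measurableType d}
  {Omega : measurableType dO} {R : realType} {Theta : Type}.
Variables (P : Theta -> probability Omega R) (X : nat -> {mfun Omega >-> T}).
Variables (mu : {sigma_finite_measure set T -> \bar R}).
Variable f : Theta -> forall n : nat, n.-tuple T -> R.
Hypothesis hf : has_densities P X mu f.

Lemma observeS n w : observe X n.+1 w = snoc (observe X n w, X n.+1 w).
Proof.
apply: eq_from_tnth => i; rewrite tnth_mktuple (tnth_nth (X n.+1 w)) /=.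
rewrite nth_rcons size_map size_enum_ord; case: ltnP => [lin|ni].
  rewrite (nth_map (Ordinal lin)) ?size_enum_ord//.
  by rewrite -[X in nth _ _ X]/(val (Ordinal lin)) nth_ord_enum.
have -> : i = n :> nat by apply/eqP; rewrite eqn_leq ni -ltnS ltn_ord.
by rewrite eqxx.
Qed.

Lemma measurable_observe n : measurable_fun [set: Omega] (@observe _ _ T Omega X n).
Proof.
apply/measurable_fun_tnthP => i.
rewrite (_ : _ \o _ = X i.+1); first exact: measurable_funP.
by apply/funext => w /=; rewrite tnth_mktuple.
Qed.

Lemma expect_density th n (F : n.-tuple T -> R) : (0 < n)%N ->
  measurable_fun [set: n.-tuple T] F -> (forall x, (0 <= F x)%R) ->
  expect P X th F =
  \int[power_measure mu n]_x ((F x)%:E * (f th x)%:E).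
Proof.
move=> n0 mF F0; have [mf f0 fE] := hf th n0.
pose obs : {mfun Omega >-> n.-tuple T} := HB.pack (@observe _ _ T Omega X n)
  (isMeasurableFun.Build _ _ _ _ _ (@measurable_observe n)).
rewrite -(@integral_density _ _ _ _ (pushforward (P th) obs) _ mf f0 fE (EFin \o F)).
- rewrite ge0_integral_pushforward ?preimage_setT//.
  + by rewrite /expect unlock.
  + exact/measurable_EFinP.
  + by move=> x _; rewrite lee_fin.
- exact/measurable_EFinP.
- by move=> x; rewrite lee_fin.
Qed.

End Law.

(** * The risk of stopping *)

Section Testing.
Context {d dO : measure_display} {T : measurableType d}
  {Omega : measurableType dO} {R : realType} {Theta : Type}.
Variables (P : Theta -> probability Omega R) (X : nat -> {mfun Omega >-> T}).
Variables (mu : {sigma_finite_measure set T -> \bar R}).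
Variable f : Theta -> forall n : nat, n.-tuple T -> R.
Hypothesis hf : has_densities P X mu f.
Variables (k : nat) (k_gt0 : (0 < k)%N).
Variables (ths : 'I_k -> Theta) (th0 : Theta).
Variable lambda : 'I_k -> 'I_k -> R.
Hypothesis hlambda : forall i j : 'I_k, i != j -> (0 <= lambda i j)%R.

Local Notation "'mu^' n" := (power_measure mu n)
  (at level 2, n at level 1, format "'mu^' n").
Local Notation ell := (ell ths lambda f).

Lemma measurable_f th n : (0 < n)%N ->
  measurable_fun [set: n.-tuple T] (f th (n:=n)).
Proof. by move=> /(hf th)[]. Qed.

Lemma f_ge0 th n (x : n.-tuple T) : (0 < n)%N -> (0 <= f th x)%R.
Proof. by move=> /(hf th)[_ /(_ x)]. Qed.

(** The density of the weighted error made by accepting hypothesis [j]. *)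
Definition risk n (j : 'I_k) (x : n.-tuple T) : R :=
  (\sum_(i < k | i != j) lambda i j * f (ths i) x)%R.

Lemma risk_ge0 n (j : 'I_k) (x : n.-tuple T) : (0 < n)%N -> (0 <= risk j x)%R.
Proof.
by move=> n0; apply: sumr_ge0 => i ij; rewrite mulr_ge0 ?hlambda// f_ge0.
Qed.

Lemma measurable_risk n (j : 'I_k) : (0 < n)%N ->
  measurable_fun [set: n.-tuple T] (@risk n j).
Proof.
move=> n0; rewrite (_ : @risk n j = fun x => (\sum_(i < k)
    if i != j then lambda i j * f (ths i) x else 0)%R); last first.
  by apply/funext => x; rewrite /risk big_mkcond.
apply: (@measurable_sum _ _ _ _ _ _ (fun i (x : n.-tuple T) =>
  if i != j then lambda i j * f (ths i) x else 0)%R) => i.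
by case: eqP => //= _; apply: measurable_funM => //; exact: measurable_f.
Qed.

Lemma ell_le n (j : 'I_k) (x : n.-tuple T) : ell x <= (risk j x)%:E.
Proof. by rewrite /Defs.ell (bigD1 j)//= ge_min lexx. Qed.

Lemma ell_attained n (x : n.-tuple T) : exists j, ell x = (risk j x)%:E.
Proof.
pose j0 := Ordinal k_gt0.
have [j _ jmin] := @Order.TotalTheory.arg_minP _ _ _ j0 xpredT (fun j => risk j x) isT.
exists j; apply/eqP; rewrite eq_le ell_le/=.
rewrite /Defs.ell; elim/big_rec: _ => [|i y _ h]; first exact: leey.
by rewrite le_min h andbT lee_fin jmin.
Qed.

Lemma ell_ge0 n (x : n.-tuple T) : (0 < n)%N -> 0 <= ell x.
Proof. by move=> n0; have [j ->] := ell_attained x; rewrite lee_fin risk_ge0. Qed.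

Lemma measurable_ell n : (0 < n)%N ->
  measurable_fun [set: n.-tuple T] (@Defs.ell _ T R Theta k ths lambda f n).
Proof.
move=> n0; rewrite (_ : Defs.ell _ _ _ (n:=n) = fun x : n.-tuple T =>
  \big[Order.min/+oo]_(j < k) (risk j x)%:E)//.
elim: (index_enum _) => [|j s IH].
  rewrite (_ : (fun x => _) = cst +oo)//.
  by apply/funext => x; rewrite big_nil.
rewrite (_ : (fun x => _) = (fun x : n.-tuple T => mine (risk j x)%:E
   (\big[Order.min/+oo]_(j <- s) (risk j x)%:E))); last first.
  by apply/funext => x; rewrite big_cons.
apply: measurable_mine; last exact: IH.
by apply/measurable_EFinP; exact: measurable_risk.
Qed.

Lemma integral_f th n : (0 < n)%N -> \int[mu^n]_x (f th x)%:E = 1.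
Proof.
move=> n0; have [_ _ /(_ setT measurableT)] := hf th n0.
by rewrite preimage_setT => <-; exact: probability_setT.
Qed.

(** Accepting always the same hypothesis [j] bounds the integral by the sum of
    the [lambda i j]. *)
Lemma integral_ell_lty n : (0 < n)%N -> \int[mu^n]_x ell x < +oo.
Proof.
move=> n0; pose j := Ordinal k_gt0.
have mlf i : measurable_fun [set: n.-tuple T]
    (fun x => (lambda i j * f (ths i) x)%:E).
  by apply/measurable_EFinP/measurable_funM => //; exact: measurable_f.
apply: (@le_lt_trans _ _ (\int[mu^n]_x (risk j x)%:E)).
  apply: ge0_le_integral => //.
  - by move=> x _; exact: ell_ge0.
  - exact: measurable_ell.
  - by apply/measurable_EFinP; exact: measurable_risk.
  - by move=> x _; exact: ell_le.
under eq_integral do rewrite /risk -sumEFin big_mkcond.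
rewrite (@ge0_integral_sum _ _ _ _ _ _ _ (fun i (x : n.-tuple T) =>
  if i != j then (lambda i j * f (ths i) x)%:E else 0))//.
- apply: lte_sum_pinfty => i _; case: eqP => [_|/eqP ij] /=.
    by rewrite integral0 ltry.
  under eq_integral do rewrite EFinM.
  rewrite ge0_integralZl ?integral_f ?mule1 ?ltry ?lee_fin ?hlambda//.
    by apply/measurable_EFinP; exact: measurable_f.
  by move=> x _; rewrite lee_fin f_ge0.
- by move=> i; case: (i != j); [exact: mlf|exact: measurable_cst].
- move=> i x _; case: ifP => // ij; rewrite lee_fin mulr_ge0 ?hlambda//.
  exact: f_ge0.
Qed.

(** * Backward induction *)

Local Notation V_steps := (V_steps ths th0 lambda mu f).
Local Notation V_lim := (V_lim ths th0 lambda mu f).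
Local Notation Rcont := (Rcont ths th0 lambda mu f).

Lemma V_steps_ge0 s n (x : n.-tuple T) : (0 < n)%N -> 0 <= V_steps s x.
Proof.
elim: s n x => [|s IH] n x n0 /=; first exact: ell_ge0.
rewrite le_min ell_ge0//= adde_ge0 ?lee_fin ?f_ge0//.
by apply: integral_ge0 => y _; exact: IH.
Qed.

Lemma measurable_V_steps s n : (0 < n)%N ->
  measurable_fun [set: n.-tuple T]
    (@Defs.V_steps _ T R _ k ths th0 lambda mu f s n).
Proof.
elim: s n => [|s IH] n n0 /=; first exact: measurable_ell.
apply: measurable_mine; first exact: measurable_ell.
apply: emeasurable_funD; first by apply/measurable_EFinP; exact: measurable_f.
apply: measurable_integral_snoc; first exact: IH.
by move=> x; exact: V_steps_ge0.
Qed.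

(** A longer horizon leaves more strategies available. *)
Lemma V_steps_noninc n (x : n.-tuple T) : (0 < n)%N ->
  nonincreasing_seq (fun s => V_steps s x).
Proof.
move=> n0; apply/nonincreasing_seqP => s.
elim: s n x n0 => [|s IH] n x n0 /=; first by rewrite ge_min lexx.
rewrite le_min !ge_min lexx/= leeD2l ?orbT//; apply: ge0_le_integral => //.
- by move=> y _; exact: (@V_steps_ge0 s.+1).
- exact: (measurable_snoc_app x (@measurable_V_steps s.+1 n.+1 isT)).
- exact: (measurable_snoc_app x (@measurable_V_steps s n.+1 isT)).
- by move=> y _; exact: IH.
Qed.

Lemma V_steps_cvg n (x : n.-tuple T) : (0 < n)%N ->
  V_steps s x @[s --> \oo] --> V_lim x.
Proof.
move=> n0; have cV := ereal_nonincreasing_cvgn (V_steps_noninc x n0).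
rewrite /Defs.V_lim /V_trunc.
have := cV; rewrite -(cvg_centern n) => /cvg_lim -> //.
Qed.

Lemma V_lim_le n (x : n.-tuple T) s : (0 < n)%N -> V_lim x <= V_steps s x.
Proof.
move=> n0; apply: (cvge_le _ (V_steps_cvg n0)).
by exists s => // t /= st; exact: V_steps_noninc.
Qed.

Lemma V_lim_ge0 n (x : n.-tuple T) : (0 < n)%N -> 0 <= V_lim x.
Proof.
move=> n0; apply: (cvge_ge _ (V_steps_cvg n0)); apply: nearW => s.
exact: V_steps_ge0.
Qed.

Lemma measurable_V_lim n : (0 < n)%N ->
  measurable_fun [set: n.-tuple T] (@Defs.V_lim _ T R _ k ths th0 lambda mu f n).
Proof.
move=> n0; apply: (emeasurable_fun_cvg
  (fun s => @Defs.V_steps _ T R _ k ths th0 lambda mu f s n)).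
  by move=> s; exact: measurable_V_steps.
by move=> x _; exact: V_steps_cvg.
Qed.

Lemma Rcont_ge0 n (x : n.-tuple T) : 0 <= Rcont x.
Proof. by apply: integral_ge0 => y _; exact: V_lim_ge0. Qed.

Lemma measurable_Rcont n :
  measurable_fun [set: n.-tuple T] (@Defs.Rcont _ T R _ k ths th0 lambda mu f n).
Proof.
apply: measurable_integral_snoc; first exact: measurable_V_lim.
by move=> x; exact: V_lim_ge0.
Qed.

(** For almost every [x] the function [ell (snoc (x, _))] is integrable, and it
    dominates the truncated values; so the integral passes to the limit in their
    recursion. *)
Lemma V_lim_bellman n : (0 < n)%N ->
  {ae mu^n, forall x, V_lim x = mine (ell x) ((f th0 x)%:E + Rcont x)}.
Proof.
move=> n0.
have mI : measurable_fun [set: n.-tuple T]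
    (fun x => \int[mu]_y ell (snoc (x, y))).
  apply: measurable_integral_snoc; first exact: measurable_ell.
  by move=> x; exact: ell_ge0.
have iI : (mu^n).-integrable [set: n.-tuple T]
    (fun x => \int[mu]_y ell (snoc (x, y))).
  apply/integrableP; split => //.
  under eq_integral.
    move=> x _; rewrite gee0_abs; last first.
      by apply: integral_ge0 => y _; exact: ell_ge0.
    over.
  rewrite -integral_power_measureS.
  - exact: integral_ell_lty.
  - exact: measurable_ell.
  - by move=> x; exact: ell_ge0.
have := integrable_ae measurableT iI; apply: filterS => x /(_ Logic.I) fI.
have iy : mu.-integrable [set: T] (fun y => ell (snoc (x, y))).
  apply/integrableP; split.
    exact: (measurable_snoc_app x (@measurable_ell n.+1 isT)).
  under eq_integral => y _ do rewrite gee0_abs ?ell_ge0//.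
  by rewrite ltey_eq fI.
have Vell : {ae mu, forall y (s : nat), [set: T] y ->
    `|V_steps s (snoc (x, y))| <= ell (snoc (x, y))}.
  apply: aeW => y s _; rewrite gee0_abs; last exact: V_steps_ge0.
  by have := V_steps_noninc (snoc (x, y)) isT (leq0n s).
have cV : {ae mu, forall y, [set: T] y ->
    V_steps s (snoc (x, y)) @[s --> \oo] --> V_lim (snoc (x, y))}.
  by apply: aeW => y _; exact: V_steps_cvg.
have [_ _] := dominated_convergence measurableT
  (fun s => measurable_snoc_app x (@measurable_V_steps s n.+1 isT))
  (measurable_snoc_app x (@measurable_V_lim n.+1 isT)) cV iy Vell.
rewrite -/(Rcont x) => cR.
apply/eqP; rewrite eq_le; apply/andP; split.
- rewrite le_min (V_lim_le x 0 n0)//=.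
  have cfR : (f th0 x)%:E + \int[mu]_y V_steps s (snoc (x, y)) @[s --> \oo]
      --> (f th0 x)%:E + Rcont x.
    by apply: cvgeD => //; exact: cvg_cst.
  apply: (cvge_ge _ cfR); apply: nearW => s.
  apply: (le_trans (V_lim_le x s.+1 n0)); rewrite /= ge_min lexx orbT//.
- apply: (cvge_ge _ (V_steps_cvg n0)); exists 1%N => // -[//|s] _ /=.
  rewrite le_min !ge_min lexx/= leeD2l ?orbT//; apply: ge0_le_integral => //.
  + by move=> y _; exact: V_lim_ge0.
  + exact: (measurable_snoc_app x (@measurable_V_lim n.+1 isT)).
  + exact: (measurable_snoc_app x (@measurable_V_steps s n.+1 isT)).
  + by move=> y _; exact: V_lim_le.
Qed.

Lemma continue_cost_ge0 n (x : n.-tuple T) : (0 < n)%N -> 0 <= (f th0 x)%:E + Rcont x.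
Proof. by move=> n0; rewrite adde_ge0 ?Rcont_ge0// lee_fin f_ge0. Qed.

Lemma measurable_continue_cost n : (0 < n)%N ->
  measurable_fun [set: n.-tuple T] (fun x => (f th0 x)%:E + Rcont x).
Proof.
move=> n0; apply: emeasurable_funD; last exact: measurable_Rcont.
by apply/measurable_EFinP; exact: measurable_f.
Qed.

(** * The cost of a fixed stopping rule *)

Section FixedRule.
Variable psi : forall n : nat, n.-tuple T -> R.
Hypothesis hpsi : stopping_rule psi.

(** The probability of tau >= n: tau exceeds n - 1 when none of the first n - 1
    stages is a stop. *)
Definition surv_prob n : \bar R := expect P X th0 (@cont_prob _ T R psi n).

(** Given the observations, the conditional probabilities of stopping at stage
    [n] and of going past it. *)
Definition stop_weight n (x : n.-tuple T) : R := (cont_prob psi x * psi x)%R.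

Lemma stop_weight_ge0 n (x : n.-tuple T) : (0 < n)%N -> (0 <= stop_weight x)%R.
Proof. by move=> n0; rewrite mulr_ge0 ?cont_prob_ge0 ?psi_ge0. Qed.

Lemma measurable_stop_weight n : (0 < n)%N ->
  measurable_fun [set: n.-tuple T] (@stop_weight n).
Proof.
move=> n0; apply: measurable_funM; first exact: measurable_cont_prob.
exact: measurable_psi.
Qed.

Definition pass_weight n (x : n.-tuple T) : R :=
  (cont_prob psi x * (1 - psi x))%R.

Lemma pass_weight_ge0 n (x : n.-tuple T) : (0 < n)%N -> (0 <= pass_weight x)%R.
Proof. by move=> n0; rewrite mulr_ge0 ?cont_prob_ge0 ?onem_psi_ge0. Qed.

Lemma measurable_pass_weight n : (0 < n)%N ->
  measurable_fun [set: n.-tuple T] (@pass_weight n).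
Proof.
move=> n0; apply: measurable_funM; first exact: measurable_cont_prob.
by apply: measurable_funB => //; exact: measurable_psi.
Qed.

Lemma surv_prob1 : surv_prob 1 = 1.
Proof.
rewrite /surv_prob /expect unlock; under eq_integral do rewrite /= cont_prob1.
by rewrite integral_cst//= probability_setT mul1e.
Qed.

(** Passing from [n + 1] to [n] observations takes place on [Omega], where both
    expectations are of the same random variable. *)
Lemma surv_probS n : (0 < n)%N ->
  surv_prob n.+1 = \int[mu^n]_x ((pass_weight x)%:E * (f th0 x)%:E).
Proof.
move=> n0; rewrite -(expect_density hf)//; last 2 first.
  exact: measurable_pass_weight.
  by move=> x; exact: pass_weight_ge0.
rewrite /surv_prob /expect; congr ('E__[_]); apply/funext => w /=.
by rewrite observeS cont_prob_snoc.
Qed.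

Lemma surv_probD n : (0 < n)%N ->
  surv_prob n = stop_prob P X th0 psi n + surv_prob n.+1.
Proof.
move=> n0; rewrite surv_probS// /surv_prob /stop_prob.
rewrite !(expect_density hf)//; last 4 first.
- exact: measurable_stop_weight.
- by move=> x; exact: stop_weight_ge0.
- exact: measurable_cont_prob.
- by move=> x; exact: cont_prob_ge0.
rewrite -ge0_integralD//.
- apply: eq_integral => x _; rewrite -!EFinM -EFinD; congr EFin.
  by rewrite /pass_weight; ring.
- by move=> x _; rewrite -EFinM lee_fin mulr_ge0 ?stop_weight_ge0// f_ge0.
- apply: emeasurable_funM; apply/measurable_EFinP; last exact: measurable_f.
  exact: measurable_stop_weight.
- by move=> x _; rewrite -EFinM lee_fin mulr_ge0 ?pass_weight_ge0// f_ge0.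
- apply: emeasurable_funM; apply/measurable_EFinP; last exact: measurable_f.
  exact: measurable_pass_weight.
Qed.

Lemma surv_prob_ge0 n : 0 <= surv_prob n.
Proof.
rewrite /surv_prob /expect unlock; apply: integral_ge0 => w _.
by rewrite lee_fin cont_prob_ge0.
Qed.

Lemma surv_prob_fin_num n : surv_prob n \is a fin_num.
Proof.
rewrite ge0_fin_numE ?surv_prob_ge0//.
apply: (@le_lt_trans _ _ 1); last exact: ltry.
rewrite /surv_prob /expect unlock -[leRHS](@probability_setT _ _ _ (P th0)).
rewrite -[leRHS]mul1e -(integral_cst (P th0) measurableT 1).
apply: ge0_le_integral => //.
- by move=> w _; rewrite lee_fin cont_prob_ge0.
- apply/measurable_EFinP; apply: measurableT_comp.
    exact: measurable_cont_prob.
  exact: measurable_observe.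
- by move=> w _; rewrite lee_fin cont_prob_le1.
Qed.

Lemma stop_prob_ge0 n : (0 < n)%N -> 0 <= stop_prob P X th0 psi n.
Proof.
move=> n0; rewrite /stop_prob /expect unlock; apply: integral_ge0 => w _.
by rewrite lee_fin stop_weight_ge0.
Qed.

Lemma stop_prob_fin_num n : (0 < n)%N -> stop_prob P X th0 psi n \is a fin_num.
Proof.
move=> n0; have := surv_prob_fin_num n; rewrite surv_probD// fin_numD.
by case/andP.
Qed.

Lemma avg_sample_surv :
  avg_sample P X th0 psi = \sum_(1 <= n <oo) surv_prob n.
Proof.
have := @expectation_tail_sum R (fun n => fine (surv_prob n))
  (fun n => fine (stop_prob P X th0 psi n)).
rewrite /avg_sample /stop_finite_prob.
rewrite (eq_eseries_from (v := stop_prob P X th0 psi)); last first.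
  by move=> n n0; rewrite fineK// stop_prob_fin_num.
rewrite (eq_eseries_from (u := fun n => n%:R%:E * (fine _)%:E)
  (v := fun n => n%:R%:E * stop_prob P X th0 psi n)); last first.
  by move=> n n0; rewrite fineK// stop_prob_fin_num.
rewrite (eq_eseries_from (u := fun n => (fine (surv_prob n))%:E)
  (v := surv_prob)); last by move=> n n0; rewrite fineK// surv_prob_fin_num.
apply.
- by move=> n; rewrite fine_ge0// surv_prob_ge0.
- by move=> n n0; rewrite fine_ge0// stop_prob_ge0.
- by rewrite surv_prob1.
- move=> n n0; rewrite -fineD ?stop_prob_fin_num ?surv_prob_fin_num//.
  by rewrite -surv_probD.
Qed.

Definition stop_risk n : \bar R := \int[mu^n]_x ((stop_weight x)%:E * ell x).

Lemma stop_risk_ge0 n : (0 < n)%N -> 0 <= stop_risk n.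
Proof.
move=> n0; apply: integral_ge0 => x _; apply: mule_ge0; last exact: ell_ge0.
by rewrite lee_fin; exact: stop_weight_ge0.
Qed.

Definition decided_risk (phi : forall n : nat, n.-tuple T -> 'I_k -> R)
  n (x : n.-tuple T) : R := (\sum_(j < k) phi n x j * risk j x)%R.

Lemma ell_le_decided_risk phi n (x : n.-tuple T) : (0 < n)%N ->
  decision_rule phi -> ell x <= (decided_risk phi x)%:E.
Proof.
move=> n0 /(_ n n0)[_ /(_ x)[phi0 phi1]].
have [j0 elj0] := ell_attained x; rewrite elj0 lee_fin.
rewrite -[leLHS]mul1r -phi1 mulr_suml; apply: ler_sum => j _.
by rewrite ler_wpM2l// -lee_fin -elj0 ell_le.
Qed.

(** All terms are nonnegative, so the sums over pairs of hypotheses, over stages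
    and over observations may be exchanged. *)
Lemma lagrangianE phi : decision_rule phi ->
  lagrangian P X ths th0 lambda psi phi = avg_sample P X th0 psi +
  \sum_(1 <= n <oo) \int[mu^n]_x ((stop_weight x)%:E * (decided_risk phi x)%:E).
Proof.
move=> hphi; rewrite /lagrangian; congr (_ + _).
have mphi n j : (0 < n)%N ->
    measurable_fun [set: n.-tuple T] (fun x => phi n x j).
  by move=> n0; have [+ _] := hphi n n0; exact.
have phi0 n j x : (0 < n)%N -> (0 <= phi n x j)%R.
  by move=> n0; have [_ /(_ x)[+ _]] := hphi n n0; exact.
have msp n j : (0 < n)%N ->
    measurable_fun [set: n.-tuple T] (fun x => (stop_weight x * phi n x j)%R).
  move=> n0; apply: measurable_funM; last exact: mphi.
  exact: measurable_stop_weight.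
have sp0 n j x : (0 < n)%N -> (0 <= stop_weight x * phi n x j)%R.
  by move=> n0; rewrite mulr_ge0 ?phi0// stop_weight_ge0.
pose lf n (p : 'I_k * 'I_k) (x : n.-tuple T) : R :=
  (if p.1 != p.2 then lambda p.1 p.2 * f (ths p.1) x else 0)%R.
pose h n p (x : n.-tuple T) := (stop_weight x * phi n x p.2 * lf n p x)%R.
have mh n p : (0 < n)%N -> measurable_fun [set: n.-tuple T] (h n p).
  move=> n0; apply: measurable_funM; first exact: msp.
  rewrite /lf; case: (p.1 != p.2); last exact: measurable_cst.
  by apply: measurable_funM => //; exact: measurable_f.
have h0 n p x : (0 < n)%N -> (0 <= h n p x)%R.
  move=> n0; apply: mulr_ge0; first exact: sp0.
  by rewrite /lf; case: ifP => // pp; rewrite mulr_ge0 ?hlambda// f_ge0.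
(* The guard keeps the terms nonnegative at n = 0, where psi and phi are
   arbitrary. *)
pose w p n : \bar R := if (0 < n)%N then \int[mu^n]_x (h n p x)%:E else 0.
have w0 p n : 0 <= w p n.
  rewrite /w; case: ifP => // n0; apply: integral_ge0 => x _.
  by rewrite lee_fin h0.
transitivity (\sum_p \sum_(1 <= n <oo) w p n).
  rewrite -(pair_bigA _ (fun i j => \sum_(1 <= n <oo) w (i, j) n))/=.
  apply: eq_bigr => i _; rewrite big_mkcond; apply: eq_bigr => j _.
  case: ifPn => ij; last first.
    rewrite eseries0// => n n0 _; rewrite /w n0 integral0_eq// => x _.
    by rewrite /h /lf/= (negbTE ij) mulr0.
  rewrite /error_prob nneseriesZl_from; last first.
    move=> n n0; rewrite (expect_density hf)//.
    - apply: integral_ge0 => x _; rewrite -EFinM lee_fin mulr_ge0 ?f_ge0//.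
      exact: sp0.
    - exact: msp.
    - by move=> x; exact: sp0.
  apply: eq_eseries_from => n n0; rewrite (expect_density hf)//.
  - rewrite /w n0 -ge0_integralZl//.
    + apply: eq_integral => x _; rewrite -!EFinM; congr EFin.
      by rewrite /h /lf /= ij /stop_weight; ring.
    + apply: emeasurable_funM; apply/measurable_EFinP; first exact: msp.
      exact: measurable_f.
    + move=> x _; rewrite -EFinM lee_fin mulr_ge0 ?f_ge0//; exact: sp0.
    + by rewrite lee_fin hlambda.
  - exact: msp.
  - by move=> x; exact: sp0.
rewrite -nneseries_sum//; apply: eq_eseries_from => n n0.
transitivity (\int[mu^n]_x (\sum_p (h n p x)%:E)).
  rewrite (@ge0_integral_sum _ _ _ _ _ _ _ (fun p x => (h n p x)%:E))//.
  - by apply: eq_bigr => p _; rewrite /w n0.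
  - by move=> p; apply/measurable_EFinP; exact: mh.
  - by move=> p x _; rewrite lee_fin h0.
apply: eq_integral => x _; rewrite sumEFin -EFinM; congr EFin.
rewrite -(pair_bigA _ (fun i j => h n (i, j) x)) exchange_big /=.
rewrite /decided_risk mulr_sumr; apply: eq_bigr => j _.
rewrite mulrA /risk mulr_sumr [RHS]big_mkcond; apply: eq_bigr => i _.
by rewrite /h /lf /=; case: ifP => //; rewrite mulr0.
Qed.

(** The strict inequality below [j] breaks ties in favour of the least index,
    so that exactly one hypothesis qualifies. *)
Definition is_argmin n (x : n.-tuple T) (j : 'I_k) : bool :=
  [forall i : 'I_k,
    if (i < j)%N then risk j x < risk i x else risk j x <= risk i x]%R.

Lemma exists_argmin n (x : n.-tuple T) : exists j, is_argmin x j.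
Proof.
have [j1 elj1] := ell_attained x.
have [j /eqP ej jmin] := @arg_minnP _ j1 (fun j => risk j x == risk j1 x)
  (fun j => j : nat) (eqxx _).
have minj1 i : (risk j1 x <= risk i x)%R by rewrite -lee_fin -elj1 ell_le.
exists j; apply/forallP => i; rewrite ej; case: ifPn => // ij.
rewrite lt_neqAle minj1 andbT; apply: contraL ij => /eqP ri.
by rewrite -leqNgt jmin//= -ri.
Qed.

Lemma argmin_uniq n (x : n.-tuple T) i j : is_argmin x i -> is_argmin x j -> i = j.
Proof.
wlog ij : i j / (i < j)%N.
  move=> W mi mj; have [ij|ji|/val_inj//] := ltngtP i j; first exact: W.
  by apply/esym; apply: W.
move=> /forallP/(_ j); rewrite ltnNge (ltnW ij)/= => rij /forallP/(_ i).
by rewrite ij ltNge rij.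
Qed.

Lemma argmin_ell n (x : n.-tuple T) j : is_argmin x j -> ell x = (risk j x)%:E.
Proof.
move=> /forallP mj; apply/eqP; rewrite eq_le ell_le/=.
have [i ->] := ell_attained x; rewrite lee_fin.
by have := mj i; case: ifP => // _ /ltW.
Qed.

Definition bayes_rule : forall n : nat, n.-tuple T -> 'I_k -> R :=
  fun n x j => \1_[set z : n.-tuple T | is_argmin z j] x.

Lemma bayes_ruleE n (x : n.-tuple T) j (g : 'I_k -> R) : is_argmin x j ->
  (\sum_(i < k) bayes_rule x i * g i)%R = g j.
Proof.
move=> mj; rewrite (bigD1 j)//= big1 => [|i ij].
  by rewrite /bayes_rule indicE mem_set// mul1r addr0.
rewrite /bayes_rule indicE memNset ?mul0r//= => mi.
by move/eqP : ij; apply; exact: argmin_uniq mi mj.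
Qed.

Lemma decision_bayes_rule : decision_rule bayes_rule.
Proof.
move=> n n0; split => [j|x].
- apply: measurable_indic.
  rewrite (_ : [set _ | _] = \bigcap_(i in [set: 'I_k]) [set z : n.-tuple T |
      if (i < j)%N then (risk j z < risk i z)%R else (risk j z <= risk i z)%R]).
    apply: fin_bigcap_measurable => // i _; case: ltnP => _.
      rewrite -[X in measurable X]setTI.
      apply: (measurable_lte measurableT (f := EFin \o @risk n j)
        (g := EFin \o @risk n i)); apply/measurable_EFinP;
        exact: measurable_risk.
    rewrite -[X in measurable X]setTI.
    apply: (measurable_lee measurableT (f := EFin \o @risk n j)
      (g := EFin \o @risk n i)); apply/measurable_EFinP;
      exact: measurable_risk.
  apply/seteqP; split => z /= => [/forallP h i _|h]; first exact: h.
  by apply/forallP => i; exact: h.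
- split => [j|]; first by rewrite /bayes_rule indicE.
  have [j mj] := exists_argmin x.
  rewrite -[RHS](bayes_ruleE (fun=> 1%R) mj).
  by apply: eq_bigr => i _; rewrite mulr1.
Qed.

(** The risk of any decision is at least [ell], and the rule [bayes_rule]
    attains it at all stages simultaneously. *)
Lemma min_lagrangianE : min_lagrangian P X ths th0 lambda psi =
  avg_sample P X th0 psi + \sum_(1 <= n <oo) stop_risk n.
Proof.
apply/eqP; rewrite eq_le; apply/andP; split.
- apply: ereal_inf_lbound; exists bayes_rule; first exact: decision_bayes_rule.
  rewrite lagrangianE; last exact: decision_bayes_rule.
  congr (_ + _); apply: eq_eseries_from => n n0; apply: eq_integral => x _.
  have [j mj] := exists_argmin x.
  by rewrite /decided_risk (bayes_ruleE _ mj) (argmin_ell mj).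
- apply: le_ereal_inf_tmp => _ [phi hphi <-]; rewrite lagrangianE// leeD2l//.
  apply: lee_nneseries_from => n n0; first exact: stop_risk_ge0.
  apply: ge0_le_integral => //.
  + move=> x _; rewrite mule_ge0 ?ell_ge0// lee_fin; exact: stop_weight_ge0.
  + apply: emeasurable_funM; last exact: measurable_ell.
    by apply/measurable_EFinP; exact: measurable_stop_weight.
  + apply: emeasurable_funM; apply/measurable_EFinP.
      exact: measurable_stop_weight.
    apply: (@measurable_sum _ _ _ _ _ _
      (fun j (x : n.-tuple T) => phi n x j * risk j x)%R) => j.
    have [mphi _] := hphi n n0.
    by apply: measurable_funM; [exact: mphi|exact: measurable_risk].
  + move=> x _; rewrite lee_wpmul2l ?lee_fin ?stop_weight_ge0//.
    exact: ell_le_decided_risk.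
Qed.

(** * The gain of one more observation *)

(** The optimal future cost, averaged over the paths that reach stage [n]. *)
Definition cont_value n : \bar R := \int[mu^n]_x ((cont_prob psi x)%:E * V_lim x).

Definition stop_optimal n : Prop :=
  {ae mu^n, forall x : n.-tuple T, cont_set psi n x ->
    (\1_[set z : n.-tuple T | (ell z < (f th0 z)%:E + Rcont z)%E] x <= psi x <=
     \1_[set z : n.-tuple T | (ell z <= (f th0 z)%:E + Rcont z)%E] x)%R}.

(* The cost of obeying psi at stage n and being optimal afterwards. *)
Let one_step n (x : n.-tuple T) : \bar R :=
  (stop_weight x)%:E * ell x + (pass_weight x)%:E * ((f th0 x)%:E + Rcont x).

(* The cost of being optimal from stage n on. *)
Let cont_mine n (x : n.-tuple T) : \bar R :=
  (cont_prob psi x)%:E * mine (ell x) ((f th0 x)%:E + Rcont x).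

Let measurable_one_step n : (0 < n)%N ->
  measurable_fun [set: n.-tuple T] (@one_step n).
Proof.
move=> n0; apply: emeasurable_funD; apply: emeasurable_funM.
- by apply/measurable_EFinP; exact: measurable_stop_weight.
- exact: measurable_ell.
- by apply/measurable_EFinP; exact: measurable_pass_weight.
- exact: measurable_continue_cost.
Qed.

Let measurable_cont_mine n : (0 < n)%N ->
  measurable_fun [set: n.-tuple T] (@cont_mine n).
Proof.
move=> n0; apply: emeasurable_funM.
- by apply/measurable_EFinP; exact: measurable_cont_prob.
- apply: measurable_mine; first exact: measurable_ell.
  exact: measurable_continue_cost.
Qed.

Let one_step_ge0 n (x : n.-tuple T) : (0 < n)%N -> 0 <= one_step x.
Proof.
move=> n0; rewrite adde_ge0// mule_ge0 ?ell_ge0 ?continue_cost_ge0// lee_fin.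
  exact: stop_weight_ge0.
exact: pass_weight_ge0.
Qed.

Let cont_mine_ge0 n (x : n.-tuple T) : (0 < n)%N -> 0 <= cont_mine x.
Proof.
move=> n0; rewrite mule_ge0 ?lee_fin ?cont_prob_ge0// le_min ell_ge0//=.
exact: continue_cost_ge0.
Qed.

Let cont_mine_le n (x : n.-tuple T) : (0 < n)%N -> cont_mine x <= one_step x.
Proof.
move=> n0; rewrite /cont_mine /one_step.
have -> : cont_prob psi x = (stop_weight x + pass_weight x)%R.
  by rewrite /stop_weight /pass_weight; ring.
rewrite EFinD ge0_muleDl ?lee_fin ?stop_weight_ge0 ?pass_weight_ge0//.
by apply: leeD; rewrite lee_wpmul2l ?lee_fin ?stop_weight_ge0 ?pass_weight_ge0//
  ge_min lexx ?orbT.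
Qed.

Let cont_mine_eq n (x : n.-tuple T) : (0 < n)%N ->
  cont_mine x = one_step x <->
  (cont_set psi n x ->
    (\1_[set z : n.-tuple T | (ell z < (f th0 z)%:E + Rcont z)%E] x <= psi x <=
     \1_[set z : n.-tuple T | (ell z <= (f th0 z)%:E + Rcont z)%E] x)%R).
Proof.
move=> n0; have memE (b : n.-tuple T -> bool) : (x \in [set z | b z]) = b x.
  by apply/idP/idP; rewrite inE.
rewrite !indicE !memE /cont_mine /one_step; have [j ->] := ell_attained x.
apply: randomized_min; [exact: cont_prob_ge0| |exact: continue_cost_ge0].
by have [_ /(_ x)] := hpsi n0.
Qed.

Let cont_V_ge0 n (x : n.-tuple T) : (0 < n)%N ->
  0 <= (cont_prob psi x)%:E * V_lim x.
Proof. by move=> n0; rewrite mule_ge0 ?V_lim_ge0// lee_fin cont_prob_ge0. Qed.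

Let measurable_cont_V n : (0 < n)%N ->
  measurable_fun [set: n.-tuple T] (fun x => (cont_prob psi x)%:E * V_lim x).
Proof.
move=> n0; apply: emeasurable_funM; last exact: measurable_V_lim.
by apply/measurable_EFinP; exact: measurable_cont_prob.
Qed.

Lemma cont_value_ge0 n : (0 < n)%N -> 0 <= cont_value n.
Proof. by move=> n0; apply: integral_ge0 => x _; exact: cont_V_ge0. Qed.

Lemma cont_valueE n : (0 < n)%N ->
  cont_value n = \int[mu^n]_x cont_mine x.
Proof.
move=> n0; apply: ge0_ae_eq_integral => //.
- exact: measurable_cont_V.
- exact: measurable_cont_mine.
- by move=> x _; exact: cont_V_ge0.
- by move=> x _; exact: cont_mine_ge0.
- by apply: filterS (V_lim_bellman n0) => x Vx _; rewrite Vx.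
Qed.

(** Reaching stage [n + 1] costs one observation on the mass that goes past [n];
    integrating out that observation turns [V_lim] into [Rcont]. *)
Lemma cont_valueS n : (0 < n)%N ->
  surv_prob n.+1 + stop_risk n + cont_value n.+1 = \int[mu^n]_x one_step x.
Proof.
move=> n0; rewrite surv_probS//.
have mpf : measurable_fun [set: n.-tuple T]
    (fun x => (pass_weight x)%:E * (f th0 x)%:E).
  apply: emeasurable_funM; apply/measurable_EFinP; last exact: measurable_f.
  exact: measurable_pass_weight.
have mpR : measurable_fun [set: n.-tuple T] (fun x => (pass_weight x)%:E * Rcont x).
  apply: emeasurable_funM; last exact: measurable_Rcont.
  by apply/measurable_EFinP; exact: measurable_pass_weight.
have msl : measurable_fun [set: n.-tuple T] (fun x => (stop_weight x)%:E * ell x).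
  apply: emeasurable_funM; last exact: measurable_ell.
  by apply/measurable_EFinP; exact: measurable_stop_weight.
have pf0 (x : n.-tuple T) : 0 <= (pass_weight x)%:E * (f th0 x)%:E.
  by rewrite mule_ge0// lee_fin ?pass_weight_ge0 ?f_ge0.
have pR0 (x : n.-tuple T) : 0 <= (pass_weight x)%:E * Rcont x.
  by rewrite mule_ge0 ?Rcont_ge0// lee_fin pass_weight_ge0.
have sl0 (x : n.-tuple T) : 0 <= (stop_weight x)%:E * ell x.
  by rewrite mule_ge0 ?ell_ge0// lee_fin stop_weight_ge0.
have -> : cont_value n.+1 = \int[mu^n]_x ((pass_weight x)%:E * Rcont x).
  rewrite /cont_value integral_power_measureS; last 2 first.
  - exact: measurable_cont_V.
  - by move=> x; exact: cont_V_ge0.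
  apply: eq_integral => x _.
  under eq_integral do rewrite cont_prob_snoc//.
  rewrite ge0_integralZl//.
  - exact: (measurable_snoc_app x (@measurable_V_lim n.+1 isT)).
  - by move=> y _; exact: V_lim_ge0.
  - by rewrite lee_fin pass_weight_ge0.
rewrite -!ge0_integralD//; last 2 first.
- by move=> x _; rewrite adde_ge0.
- exact: emeasurable_funD.
apply: eq_integral => x _; rewrite /one_step [in RHS]ge0_muleDr; last 2 first.
- by rewrite lee_fin f_ge0.
- exact: Rcont_ge0.
by rewrite addeA [in RHS](addeC (_ * _)).
Qed.

Lemma cont_value_fin_num n : (0 < n)%N -> cont_value n \is a fin_num.
Proof.
move=> n0; rewrite ge0_fin_numE ?cont_value_ge0//.
apply: le_lt_trans (integral_ell_lty n0); apply: ge0_le_integral => //.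
- by move=> x _; exact: cont_V_ge0.
- exact: measurable_cont_V.
- exact: measurable_ell.
- move=> x _; apply: (@le_trans _ _ (V_lim x)); last exact: (V_lim_le x 0).
  by rewrite -[leRHS]mul1e lee_wpmul2r ?V_lim_ge0// lee_fin cont_prob_le1.
Qed.

Lemma cont_value_le n : (0 < n)%N ->
  cont_value n <= surv_prob n.+1 + stop_risk n + cont_value n.+1.
Proof.
move=> n0; rewrite cont_valueE// cont_valueS//; apply: ge0_le_integral => //.
- by move=> x _; exact: cont_mine_ge0.
- exact: measurable_cont_mine.
- exact: measurable_one_step.
- by move=> x _; exact: cont_mine_le.
Qed.

(** Both sides integrate nonnegative functions, one below the other, so that
    equality of the finite integrals is equality almost everywhere; pointwise it
    is the optimality of a randomised choice. *)
Lemma cont_value_eq n : (0 < n)%N ->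
  cont_value n = surv_prob n.+1 + stop_risk n + cont_value n.+1 <->
  stop_optimal n.
Proof.
move=> n0; rewrite cont_valueS//; split => [E|opt].
- have cE := cont_valueE n0.
  have : {ae mu^n, forall x, cont_mine x = one_step x}.
    apply: ge0_integral_eq_ae.
    - exact: measurable_cont_mine.
    - exact: measurable_one_step.
    - by move=> x; exact: cont_mine_ge0.
    - by move=> x; exact: one_step_ge0.
    - by apply: aeW => x; exact: cont_mine_le.
    - by rewrite -cE E.
    - by rewrite -cE ltey_eq cont_value_fin_num.
  by apply: filterS => x; rewrite cont_mine_eq.
- rewrite cont_valueE//; apply: ge0_ae_eq_integral => //.
  + exact: measurable_cont_mine.
  + exact: measurable_one_step.
  + by move=> x _; exact: cont_mine_ge0.
  + by move=> x _; exact: one_step_ge0.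
  + by apply: filterS opt => x + _; rewrite -cont_mine_eq.
Qed.

(** * The optimal value *)

Definition cost_until n : \bar R :=
  \sum_(1 <= i < n.+1) surv_prob i + \sum_(1 <= i < n) stop_risk i.

Lemma cost_until1 : cost_until 1 = 1.
Proof. by rewrite /cost_until big_nat1 surv_prob1 big_geq// adde0. Qed.

Lemma cost_untilS n : (0 < n)%N ->
  cost_until n.+1 = cost_until n + (surv_prob n.+1 + stop_risk n).
Proof.
move=> n0; rewrite /cost_until big_nat_recr//= [X in _ + X]big_nat_recr//=.
by rewrite addeACA.
Qed.

Lemma cost_until_cvg :
  cost_until n @[n --> \oo] --> min_lagrangian P X ths th0 lambda psi.
Proof.
rewrite min_lagrangianE avg_sample_surv.
have cs : cvgn (fun n => \sum_(1 <= i < n) surv_prob i).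
  by apply: is_cvg_nneseries => n _ _; exact: surv_prob_ge0.
have cr : cvgn (fun n => \sum_(1 <= i < n) stop_risk i).
  by apply: is_cvg_nneseries => n n0 _; exact: stop_risk_ge0.
apply: cvgeD; last exact: cr.
- apply: ge0_adde_def; rewrite inE.
    by apply: nneseries_ge0 => n _ _; exact: surv_prob_ge0.
  by apply: nneseries_ge0 => n n0 _; exact: stop_risk_ge0.
- have : \sum_(1 <= i < n + 1) surv_prob i @[n --> \oo] -->
      \sum_(1 <= i <oo) surv_prob i.
    by rewrite (cvg_shiftn 1 (fun n => \sum_(1 <= i < n) surv_prob i)); exact: cs.
  by under eq_fun do rewrite addn1.
Qed.

Lemma stop_risk_fin_num n : (0 < n)%N -> stop_risk n \is a fin_num.
Proof.
move=> n0; rewrite ge0_fin_numE ?stop_risk_ge0//.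
apply: le_lt_trans (integral_ell_lty n0); apply: ge0_le_integral => //.
- by move=> x _; rewrite mule_ge0 ?ell_ge0// lee_fin stop_weight_ge0.
- apply: emeasurable_funM; last exact: measurable_ell.
  by apply/measurable_EFinP; exact: measurable_stop_weight.
- exact: measurable_ell.
- move=> x _; rewrite -[leRHS]mul1e lee_wpmul2r ?ell_ge0// lee_fin.
  rewrite mulr_ile1 ?cont_prob_ge0 ?psi_ge0 ?cont_prob_le1//.
  by have [_ /(_ x)/andP[]] := hpsi n0.
Qed.

Lemma cost_until_fin_num n : (0 < n)%N -> cost_until n \is a fin_num.
Proof.
case: n => // n _; elim: n => [|n IH]; first by rewrite cost_until1.
rewrite cost_untilS// fin_numD IH/= fin_numD surv_prob_fin_num.
exact: stop_risk_fin_num.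
Qed.

(** The cost of following the rule before stage [n] and being optimal from there
    on. *)
Definition value_bound n : \bar R := cost_until n + cont_value n.

Lemma value_bound_le n : (0 < n)%N -> value_bound n <= value_bound n.+1.
Proof.
move=> n0; rewrite /value_bound cost_untilS//.
rewrite -(addeA (cost_until n) (_ + _)) leeD2l//.
exact: cont_value_le.
Qed.

Lemma value_bound_eq n : (0 < n)%N ->
  value_bound n = value_bound n.+1 <-> stop_optimal n.
Proof.
move=> n0; rewrite -cont_value_eq// /value_bound cost_untilS//.
rewrite -(addeA (cost_until n) (_ + _)); split => [|<-//].
by move=> /eqP; rewrite eq_le !leeD2lE ?cost_until_fin_num// -eq_le => /eqP.
Qed.

Lemma value_bound_homo m n : (0 < m)%N -> (m <= n)%N ->
  value_bound m <= value_bound n.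
Proof.
move=> m0; elim: n => [|n IH]; first by rewrite leqn0 => /eqP ->.
rewrite leq_eqVlt => /predU1P[->//|]; rewrite ltnS => mn.
by apply: (le_trans (IH mn)); apply: value_bound_le; exact: leq_trans mn.
Qed.

Definition opt_value : \bar R := 1 + \int[mu^1]_x V_lim x.

Lemma value_bound1 : value_bound 1 = opt_value.
Proof.
rewrite /value_bound cost_until1; congr (_ + _); apply: eq_integral => x _.
by rewrite cont_prob1 mul1e.
Qed.

Hypothesis htrunc : truncatable P X ths th0 lambda mu f.

(** Since [V_lim <= ell], truncatability kills the part of [value_bound] that
    lies beyond stage [n]. *)
Lemma value_bound_cvg : min_lagrangian P X ths th0 lambda psi < +oo ->
  value_bound n @[n --> \oo] --> min_lagrangian P X ths th0 lambda psi.
Proof.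
move=> Loo; rewrite -[X in _ --> X]adde0; apply: cvgeD; last first.
- have avgoo : avg_sample P X th0 psi < +oo.
    apply: le_lt_trans Loo; rewrite min_lagrangianE leeDl//.
    by apply: nneseries_ge0 => n n0 _; exact: stop_risk_ge0.
  apply: (squeeze_cvge _ (cvg_cst 0) (htrunc hpsi avgoo)).
  exists 1%N => // n /= n0; rewrite cont_value_ge0//=.
  apply: ge0_le_integral => //.
  + by move=> x _; exact: cont_V_ge0.
  + exact: measurable_cont_V.
  + apply: emeasurable_funM; last exact: measurable_ell.
    by apply/measurable_EFinP; exact: measurable_cont_prob.
  + by move=> x _; rewrite lee_wpmul2l ?lee_fin ?cont_prob_ge0// (V_lim_le x 0).
- exact: cost_until_cvg.
- exact: fin_num_adde_defl.
Qed.

Lemma value_bound_le_min n : (0 < n)%N ->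
  value_bound n <= min_lagrangian P X ths th0 lambda psi.
Proof.
move=> n0; have [Loo|] := ltP (min_lagrangian P X ths th0 lambda psi) +oo; last first.
  by rewrite leye_eq => /eqP ->; rewrite leey.
apply: (cvge_ge _ (value_bound_cvg Loo)).
by exists n => // m /= nm; exact: value_bound_homo.
Qed.

Lemma opt_value_le : opt_value <= min_lagrangian P X ths th0 lambda psi.
Proof. by rewrite -value_bound1 value_bound_le_min. Qed.

(** An increasing sequence from [opt_value] to the Lagrangian has equal ends
    exactly when all its steps vanish.  In the converse direction the bound
    [cost_until n <= opt_value] yields the finiteness of the Lagrangian. *)
Lemma min_lagrangian_opt : min_lagrangian P X ths th0 lambda psi = opt_value <->
  forall n, (1 <= n)%N -> stop_optimal n.
Proof.
split => [L n n0|opt].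
  apply/(value_bound_eq n0)/eqP; rewrite eq_le value_bound_le//=.
  apply: (@le_trans _ _ opt_value); first by rewrite -L value_bound_le_min.
  by rewrite -value_bound1 value_bound_homo.
have vE n : (0 < n)%N -> value_bound n = opt_value.
  case: n => [//|n] _; elim: n => [|n IH]; first exact: value_bound1.
  by rewrite -IH; apply/esym/value_bound_eq => //; exact: opt.
apply/eqP; rewrite eq_le opt_value_le andbT.
apply: (cvge_le _ cost_until_cvg); exists 1%N => // n /= n0.
by rewrite -(vE n n0) /value_bound leeDl// cont_value_ge0.
Qed.

End FixedRule.

Definition bellman_rule n (x : n.-tuple T) : R :=
  \1_[set z : n.-tuple T | ell z <= (f th0 z)%:E + Rcont z] x.

Lemma stopping_bellman_rule : stopping_rule bellman_rule.
Proof.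
move=> n n0; split => [|x]; last first.
  by rewrite /bellman_rule indicE; case: (_ \in _); rewrite /= ?lexx ?ler01.
apply: measurable_indic; rewrite -[X in measurable X]setTI.
apply: measurable_lee => //; first exact: measurable_ell.
exact: measurable_continue_cost.
Qed.

Lemma bellman_rule_optimal n : stop_optimal bellman_rule n.
Proof.
apply: aeW => x _; rewrite lexx andbT /bellman_rule !indicE ler_nat.
case: (boolP (x \in [set z | _ < _])) => [/set_mem/= /ltW h|//].
by rewrite mem_set.
Qed.

End Testing.

Theorem theorem6 (R : realType) (d dO : measure_display)
  (T : measurableType d) (Omega : measurableType dO) (Theta : Type)
  (mu : {sigma_finite_measure set T -> \bar R})
  (P : Theta -> probability Omega R) (X : nat -> {mfun Omega >-> T})
  (f : Theta -> forall n : nat, n.-tuple T -> R)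
  (hf : has_densities P X mu f)
  (k : nat) (hk : (2 <= k)%N)
  (ths : 'I_k -> Theta) (th0 : Theta)
  (lambda : 'I_k -> 'I_k -> R)
  (hlambda : forall i j : 'I_k, i != j -> (0 <= lambda i j)%R)
  (htrunc : truncatable P X ths th0 lambda mu f)
  (psi : forall n : nat, n.-tuple T -> R) (hpsi : stopping_rule psi) :
  min_lagrangian P X ths th0 lambda psi =
    ereal_inf [set min_lagrangian P X ths th0 lambda psi' |
                psi' in @stopping_rule d T R]
  <->
  (forall m : nat, (1 <= m)%N ->
    {ae power_measure mu m, forall x : m.-tuple T, cont_set psi m x ->
      (\1_[set z : m.-tuple T |
             (ell ths lambda f z < (f th0 m z)%:E + Rcont ths th0 lambda mu f z)%E] x
         <= psi m x <=
       \1_[set z : m.-tuple T |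
             (ell ths lambda f z <= (f th0 m z)%:E + Rcont ths th0 lambda mu f z)%E] x)%R}).
Proof.
have k0 : (0 < k)%N := ltnW hk.
rewrite -(min_lagrangian_opt hf k0 hlambda hpsi htrunc).
suff -> : ereal_inf [set min_lagrangian P X ths th0 lambda psi' |
    psi' in @stopping_rule d T R] = opt_value mu f ths th0 lambda by [].
apply/eqP; rewrite eq_le; apply/andP; split.
- have hb := stopping_bellman_rule hf k0 ths th0 hlambda.
  apply: ereal_inf_lbound; exists (bellman_rule mu f ths th0 lambda) => //.
  apply/(min_lagrangian_opt hf k0 hlambda hb htrunc) => n _.
  exact: bellman_rule_optimal.
- apply: le_ereal_inf_tmp => _ [psi' hpsi' <-].
  exact: (opt_value_le hf).
Qed.
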